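(* For all integers $n\geq k\geq1$, \[\sum_{j=k}^{n}A_{n,j}B_{j,k}=\delta_{n,k}\qquad\text{and}\qquad\sum_{j=k}^{n}B_{n,j}A_{j,k}=\delta_{n,k},\] where $\delta_{n,k}$ is the Kronecker delta.
   Context: Let $R=\mathbb{Z}[X_1,X_1^{-1},X_2,X_3,\ldots]$. Partial exponential Bell polynomials: $B_{0,0}=1$, $B_{n,0}=0$ for $n\geq1$, $B_{n,k}=0$ for $0\leq n<k$, and for $1\leq k\leq n$, $B_{n,k}=\sum \frac{n!}{r_1!\cdots r_{n-k+1}!\,(1!)^{r_1}\cdots((n-k+1)!)^{r_{n-k+1}}}X_1^{r_1}\cdots X_{n-k+1}^{r_{n-k+1}}$, summed over nonnegative integers $r_i$ with $\sum r_i=k$, $\sum i r_i=n$. Elements $S_{n,k}\in R$ are defined by $S_{0,0}=X_1^{-1}$, $S_{n,0}=0$ ($n\geq1$), $S_{n,k}=0$ ($0\leq n<k$), and for $n\geq0$, $1\leq k\leq n+1$: $S_{n+1,k}=-(2n-1)X_2S_{n,k}+X_1\big(S_{n,k-1}+\sum_{j=1}^{n-k+1}X_{j+1}\,\partial S_{n,k}/\partial X_j\big)$. Set $A_{n,k}:=X_1^{-(2n-1)}S_{n,k}$. *)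

(* Defs.v *)
From HB Require Import structures.
From mathcomp Require Import all_boot all_order all_algebra.
From mathcomp Require Import finmap.
From mathcomp.multinomials Require Import monalg.

Set Implicit Arguments.
Unset Strict Implicit.
Unset Printing Implicit Defensive.

Import GRing.Theory.

Local Open Scope fset_scope.
Local Open Scope ring_scope.

(* The pair (a, m) is the Laurent monomial X_1^a * \prod_(k) X_(k+2)^(m k),
   with a in Z and m : nat -> nat finitely supported. *)
Definition lmonom : Type := (int * {cmonom nat})%type.
HB.instance Definition _ := Choice.on lmonom.

Definition lmone : lmonom := (0, onecm nat).
Definition lmmul (m1 m2 : lmonom) : lmonom := (m1.1 + m2.1, mulcm m1.2 m2.2).

(* The quotient m1 / m2, whenever m2 divides m1. *)
Definition lmdiv (m1 m2 : lmonom) : lmonom := (m1.1 - m2.1, divcm m1.2 m2.2).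

(* The monomial X_j, for j >= 1; the index 0 is not used. *)
Definition lmvar (j : nat) : lmonom :=
  match j with
  | 0%N => lmone
  | 1%N => (1, onecm nat)
  | k.+2 => (0, ucm k)
  end.

(* The exponent of X_j in m, for j >= 1. *)
Definition lmexp (j : nat) (m : lmonom) : int :=
  match j with
  | 0%N => 0
  | 1%N => m.1
  | k.+2 => (m.2 k)%:Z
  end.

Lemma lmmulA : associative lmmul.
Proof. by move=> x y z; rewrite /lmmul /= addrA mulcmA. Qed.

Lemma lmmulC : commutative lmmul.
Proof. by move=> x y; rewrite /lmmul addrC mulcmC. Qed.

Lemma lmmul1m : left_id lmone lmmul.
Proof. by case=> a m; rewrite /lmmul /= add0r mul0cm. Qed.

(* R = Z[X_1, X_1^-1, X_2, X_3, ...]: finitely supported families of integer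
   coefficients indexed by lmonom.  The ring structure of monalg is not
   available here, since it requires 1 to be the only invertible monomial. *)
Definition laurent : Type := {malg int[lmonom]}.
HB.instance Definition _ := GRing.Zmodule.on laurent.

Section LaurentRing.
Implicit Types f g h : laurent.

Definition lone : laurent := << lmone >>.

Definition lmul f g : laurent :=
  \sum_(m1 <- msupp f) \sum_(m2 <- msupp g)
    << f@_m1 * g@_m2 *g lmmul m1 m2 >>.

Lemma lmulw (d1 d2 : {fset lmonom}) f g :
  msupp f `<=` d1 -> msupp g `<=` d2 ->
  lmul f g = \sum_(m1 <- d1) \sum_(m2 <- d2) << f@_m1 * g@_m2 *g lmmul m1 m2 >>.
Proof.
move=> le_d1 le_d2; rewrite /lmul (big_fset_incl _ le_d1) /=.
  apply: eq_bigr => m1 _; apply: big_fset_incl => // m _ /mcoeff_outdom ->.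
  by rewrite mulr0 monalgU0.
move=> m _ /mcoeff_outdom fm.
by rewrite big1 // => m' _; rewrite fm mul0r monalgU0.
Qed.

Lemma lmulC : commutative lmul.
Proof.
move=> f g; rewrite /lmul exchange_big /=.
by apply: eq_bigr => m1 _; apply: eq_bigr => m2 _; rewrite mulrC lmmulC.
Qed.

Lemma lmulDl : left_distributive lmul +%R.
Proof.
move=> f g h; set d := msupp f `|` msupp g.
rewrite (@lmulw d (msupp h) (f + g)) ?msuppD_le //.
rewrite (@lmulw d (msupp h) f) ?fsubsetUl // (@lmulw d (msupp h) g) ?fsubsetUr //.
rewrite -big_split; apply: eq_bigr => m1 _ /=.
rewrite -big_split; apply: eq_bigr => m2 _ /=.
by rewrite mcoeffD mulrDl monalgUD.
Qed.

Lemma lmulDr : right_distributive lmul +%R.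
Proof. by move=> f g h; rewrite !(lmulC f) lmulDl. Qed.

Lemma lmul0l : left_zero 0 lmul.
Proof. by move=> f; rewrite /lmul msupp0 big_seq_fset0. Qed.

Lemma lmul0r : right_zero 0 lmul.
Proof. by move=> f; rewrite lmulC lmul0l. Qed.

Lemma lmulUU (a b : int) (m1 m2 : lmonom) :
  lmul << a *g m1 >> << b *g m2 >> = << a * b *g lmmul m1 m2 >>.
Proof. by rewrite (lmulw msuppU_le msuppU_le) !big_seq_fset1 !mcoeffUU. Qed.

Lemma lmul1l : left_id lone lmul.
Proof.
move=> f; rewrite (lmulw msuppU_le (fsubset_refl _)) big_seq_fset1 [RHS]monalgE.
by apply: eq_bigr => m _; rewrite mcoeffUU mul1r lmmul1m.
Qed.

Lemma lmul_suml (I : Type) (r : seq I) (F : I -> laurent) g :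
  lmul (\sum_(i <- r) F i) g = \sum_(i <- r) lmul (F i) g.
Proof.
exact: (big_morph (lmul^~ g) (fun x y => lmulDl x y g) (lmul0l g)).
Qed.

Lemma lmul_sumr (I : Type) (r : seq I) (F : I -> laurent) g :
  lmul g (\sum_(i <- r) F i) = \sum_(i <- r) lmul g (F i).
Proof. exact: (big_morph (lmul g) (lmulDr g) (lmul0r g)). Qed.

Lemma lmulA : associative lmul.
Proof.
move=> f g h; rewrite [f]monalgE [g]monalgE [h]monalgE.
move: (msupp f) (msupp g) (msupp h) => d1 d2 d3.
pose U (f' : laurent) m : laurent := << f'@_m *g m >>.
rewrite -/(U f) -/(U g) -/(U h).
rewrite !(lmul_suml d1 (U f)) lmul_suml; apply: eq_bigr => m1 _.
rewrite (lmul_suml d2 (U g)) (lmul_sumr d2 (U g)) lmul_sumr lmul_suml.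
apply: eq_bigr => m2 _.
rewrite !(lmul_sumr d3 (U h)) lmul_sumr; apply: eq_bigr => m3 _.
by rewrite !lmulUU mulrA lmmulA.
Qed.

Lemma lone_neq0 : lone != 0.
Proof. by rewrite monalgU_eq0. Qed.

End LaurentRing.

HB.instance Definition _ := GRing.Zmodule_isComNzRing.Build laurent
  lmulA lmulC lmul1l lmulDl lone_neq0.

Definition X (j : nat) : laurent := << lmvar j >>.

Definition X1z (a : int) : laurent := << ((a, onecm nat) : lmonom) >>.

Lemma X1z0 : X1z 0 = 1.
Proof. by []. Qed.

Lemma X1z1 : X1z 1 = X 1.
Proof. by []. Qed.

Lemma X1zD (a b : int) : X1z (a + b) = X1z a * X1z b.
Proof. by rewrite /X1z [RHS]lmulUU mulr1 /lmmul /= mul0cm. Qed.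

(* The partial derivative with respect to X_j.  When the exponent of X_j in m
   is 0, the coefficient vanishes and the value of lmdiv is irrelevant. *)
Definition pderiv (j : nat) (f : laurent) : laurent :=
  \sum_(m <- msupp f) << f@_m * lmexp j m *g lmdiv m (lmvar j) >>.

Section Bell.
Local Open Scope nat_scope.

Lemma dvdn_fact_mul (a b : nat) : a`! * b`! %| (a + b)`!.
Proof.
by apply/dvdnP; exists 'C(a + b, a); rewrite -(bin_fact (leq_addr b a)) addKn.
Qed.

Lemma dvdn_fact_exp (i r : nat) : r`! * i.+1`! ^ r %| (i.+1 * r)`!.
Proof.
elim: r => [|r IHr]; first by rewrite muln0.
have le_i : i.+1 <= i.+1 * r.+1 by rewrite leq_pmulr.
have eq_bin : 'C(i.+1 * r.+1, i.+1) = r.+1 * 'C((i.+1 * r.+1).-1, i).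
  by apply/eqP; rewrite -(eqn_pmul2l (ltn0Sn i)) -mul_bin_diag mulnA.
rewrite -(bin_fact le_i) eq_bin -[X in _ - X]muln1 -mulnBr subn1 /=.
have -> : r.+1`! * i.+1`! ^ r.+1 = r.+1 * (i.+1`! * (r`! * i.+1`! ^ r)).
  by rewrite (factS r) expnS -mulnA; congr (_ * _); rewrite mulnCA.
by rewrite -mulnA dvdn_mul // dvdn_mull // dvdn_mul.
Qed.

(* The Euclidean division in bell_coef is exact: see bell_coefE. *)
Definition bell_coef (n l : nat) (r : 'I_l -> nat) : nat :=
  n`! %/ ((\prod_(i < l) (r i)`!) * \prod_(i < l) i.+1`! ^ r i).

Lemma bell_coefE (n l : nat) (r : 'I_l -> nat) :
  \sum_(i < l) i.+1 * r i = n ->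
  bell_coef n r * ((\prod_(i < l) (r i)`!) * \prod_(i < l) i.+1`! ^ r i) = n`!.
Proof.
move=> <-; rewrite /bell_coef divnK // -big_split /=.
elim/big_rec2: _ => // i n1 n2 _ IH.
exact: dvdn_trans (dvdn_mul (dvdn_fact_exp _ _) IH) (dvdn_fact_mul _ _).
Qed.

End Bell.

(* Here r i is the exponent of X_(i+1), for 0 <= i < n - k + 1.  The bound
   r i <= k, which makes the index type finite, follows from the condition
   that the r i sum to k. *)
Definition Bell (n k : nat) : laurent :=
  if k == 0%N then (n == 0%N)%:R
  else if (n < k)%N then 0
  else \sum_(r : {ffun 'I_(n - k).+1 -> 'I_k.+1} |
              (\sum_(i < (n - k).+1) r i == k)%N &&
              (\sum_(i < (n - k).+1) i.+1 * r i == n)%N)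
         (bell_coef n (fun i => r i : nat))%:R * \prod_(i < (n - k).+1) X i.+1 ^+ r i.

Fixpoint Spoly (n k : nat) : laurent :=
  match n, k with
  | 0%N, 0%N => X1z (- 1)
  | 0%N, _.+1 => 0
  | _.+1, 0%N => 0
  | n'.+1, k'.+1 =>
      if (k <= n)%N then
        - (2%:R * n'%:R - 1) * X 2 * Spoly n' k
        + X 1 * (Spoly n' k'
                 + \sum_(1 <= j < (n'.+1 - k).+1) X j.+1 * pderiv j (Spoly n' k))
      else 0
  end.

Definition Apoly (n k : nat) : laurent := X1z (- (2 * n%:Z - 1)) * Spoly n k.

(* Main.v *)
(* Both triangles obey a recurrence driven by the derivation D : X_j |-> X_(j+1):
     X_1 A_(n+1,k+1) = A_(n,k) + D A_(n,k+1)  and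
     B_(n+1,k+1) = X_1 B_(n,k) + D B_(n,k+1).
   By the Leibniz rule the D-terms cancel in the recurrence of either product
   C = AB or C = BA, leaving p C_(n+1,k+1) = D C_(n,k+1) + p C_(n,k) with p a
   unit, and C = 1 follows by induction because D kills constants.  For B, the
   recurrence comes from k B_(n,k) = sum_i binom(n,i) X_i B_(n-i,k-1). *)
Require Import Defs.
From HB Require Import structures.
From mathcomp Require Import all_boot all_order all_algebra.
From mathcomp Require Import finmap zify ring.
From mathcomp.multinomials Require Import monalg.

Import GRing.Theory Num.Theory.

Local Open Scope ring_scope.

Lemma derivation_nat (R : comNzRingType) (D : {additive R -> R}) n :
  (forall f g, D (f * g) = D f * g + f * D g) -> D n%:R = 0.
Proof.
move=> DM; have D1 : D 1 = 0.
  by apply: (addrI (D 1)); rewrite addr0 -{3}[1]mulr1 DM mulr1 mul1r.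
by rewrite raddfMn /= D1 mul0rn.
Qed.

Lemma mutually_inverse_triangles (R : comNzRingType) (D : {additive R -> R})
    (p q : R) (u v : nat -> nat -> R) (N : nat) :
    (forall f g, D (f * g) = D f * g + f * D g) -> GRing.lreg p ->
    (forall k, u 0 k = (k == 0)%:R) -> (forall n, u n.+1 0 = 0) ->
    (forall n k, (n < k)%N -> u n k = 0) ->
    (forall k, v 0 k = (k == 0)%:R) -> (forall n, v n.+1 0 = 0) ->
    (forall n k, (n < N)%N -> p * u n.+1 k.+1 = q * u n k + D (u n k.+1)) ->
    (forall n k, (n < N)%N -> q * v n.+1 k.+1 = p * v n k + D (v n k.+1)) ->
  forall n k, (n <= N)%N -> \sum_(j < N.+1) u n j * v j k = (n == k)%:R.
Proof.
move=> DM p_reg u0 uS0 u_small v0 vS0 uS vS.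
elim=> [|n IHn] k nN.
  rewrite big_ord_recl u0 mul1r v0 big1 ?addr0 1?eq_sym // => i _.
  by rewrite u0 mul0r.
case: k => [|k].
  rewrite big_ord_recl uS0 mul0r big1 ?addr0 // => i _.
  by rewrite vS0 mulr0.
apply: p_reg; rewrite big_ord_recl uS0 mul0r add0r mulr_sumr.
have -> : \sum_(i < N) p * (u n.+1 (lift ord0 i) * v (lift ord0 i) k.+1) =
    \sum_(i < N) (q * (u n i * v i.+1 k.+1) + D (u n i.+1) * v i.+1 k.+1).
  by apply: eq_bigr => i _; rewrite mulrA uS // mulrDl mulrA.
rewrite big_split /=.
have uD : \sum_(i < N) D (u n i.+1) * v i.+1 k.+1 =
    \sum_(i < N.+1) D (u n i) * v i k.+1.
  by rewrite big_ord_recl v0 mulr0 add0r.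
have D_sum : D (\sum_(i < N.+1) u n i * v i k.+1) = 0.
  by rewrite IHn ?(ltnW nN) // derivation_nat.
have {D_sum} -> : \sum_(i < N) D (u n i.+1) * v i.+1 k.+1 =
    - \sum_(i < N) u n i * D (v i k.+1).
  rewrite uD; apply/eqP; rewrite -addr_eq0; apply/eqP.
  rewrite -[RHS]D_sum raddf_sum /=.
  under [RHS]eq_bigr => i _ do rewrite DM.
  rewrite big_split /=; congr (_ + _).
  by rewrite big_ord_recr /= u_small // mul0r addr0.
rewrite -sumrB eqSS.
under eq_bigr => i _ do rewrite mulrCA vS // mulrDr addrK mulrCA.
rewrite -mulr_sumr -(IHn k (ltnW nN)) [in RHS]big_ord_recr /=.
by rewrite (u_small n N) // mul0r addr0.
Qed.

Lemma derivation_partial_Bell (R : comNzRingType) (D : {additive R -> R})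
    (x : nat -> R) (b : nat -> nat -> R) (M : nat) :
    (forall f g, D (f * g) = D f * g + f * D g) ->
    (forall i, (0 < i < M)%N -> D (x i) = x i.+1) ->
    (forall n (f g : R), f *+ n.+1 = g *+ n.+1 -> f = g) ->
    (forall n, b n 0 = (n == 0)%:R) ->
    (forall n k, k.+1%:R * b n k.+1 =
       \sum_(i < n.+1) 'C(n, i.+1)%:R * (x i.+1 * b (n - i.+1)%N k)) ->
  forall n k, (n < M)%N -> b n.+1 k.+1 = x 1 * b n k + D (b n k.+1).
Proof.
move=> DM Dx mulIn b0 b_rec n k nM.
pose prev m l := if l is l'.+1 then b m l' else 0.
suff {n k nM} bS_prev l : forall m, (m < M)%N ->
    b m.+1 l = x 1 * prev m l + D (b m l) by apply: (bS_prev k.+1).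
elim: l => [|l IHl] m mM.
  by rewrite /prev !b0 mulr0 add0r derivation_nat.
have prev_sum : \sum_(i < m.+1) 'C(m, i.+1)%:R * (x i.+1 * prev (m - i.+1)%N l) =
    l%:R * b m l.
  case: l {IHl} => [|l]; last by rewrite b_rec.
  by rewrite mul0r big1 // => i _; rewrite !mulr0.
have D_sum : l.+1%:R * D (b m l.+1) =
    \sum_(i < m.+1) 'C(m, i.+1)%:R * (x i.+2 * b (m - i.+1)%N l) +
    (\sum_(i < m.+1) 'C(m, i.+1)%:R * (x i.+1 * b (m - i)%N l) -
     x 1 * (l%:R * b m l)).
  have -> : l.+1%:R * D (b m l.+1) = D (l.+1%:R * b m l.+1).
    by rewrite DM derivation_nat // mul0r add0r.
  rewrite b_rec -prev_sum raddf_sum [x 1 * _]mulr_sumr -sumrB -big_split.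
  apply: eq_bigr => i _ /=; rewrite !DM derivation_nat // mul0r add0r.
  have [mi|im] := leqP m i.
    by rewrite bin_small // !(mul0r, mulr0) subr0 addr0.
  rewrite Dx; last by lia.
  rewrite -(subnSK im) IHl; last by lia.
  by rewrite !mulrDr (mulrCA (x 1)) (mulrCA (x 1)) addrAC subrr add0r.
apply: (mulIn l); rewrite -[LHS]mulr_natl -[RHS]mulr_natl mulrDr D_sum b_rec.
under eq_bigr => i _ do rewrite subSS binS natrD mulrDl.
rewrite big_split /= big_ord_recr /= bin_small // mul0r addr0.
rewrite [X in _ + X]big_ord_recl /= bin0 mul1r subn0.
under [X in _ + (_ + X)]eq_bigr => i _ do rewrite /bump /= add1n.
by rewrite -natr1; ring.
Qed.

Lemma laurent_ind (P : laurent -> Prop) :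
  (forall (c : int) m, P << c *g m >>) -> P 0 ->
  (forall f g, P f -> P g -> P (f + g)) -> forall f, P f.
Proof.
move=> PU P0 PD f; rewrite [f]monalgE.
by elim/big_ind: _ => // m _; apply: PU.
Qed.

Lemma pderivw j (d : {fset lmonom}) (f : laurent) : (msupp f `<=` d)%fset ->
  pderiv j f = \sum_(m <- d) << f@_m * lmexp j m *g lmdiv m (lmvar j) >>.
Proof.
move=> fd; rewrite /pderiv (big_fset_incl _ fd) //= => m _ /mcoeff_outdom ->.
by rewrite mul0r monalgU0.
Qed.

Lemma pderivD j (f g : laurent) : pderiv j (f + g) = pderiv j f + pderiv j g.
Proof.
rewrite (pderivw _ _ _ (msuppD_le f g)) (pderivw _ _ _ (fsubsetUl _ (msupp g))).
rewrite (pderivw _ _ _ (fsubsetUr (msupp f) _)) -big_split /=.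
by apply: eq_bigr => m _; rewrite mcoeffD mulrDl monalgUD.
Qed.

Lemma pderivU j (c : int) m :
  pderiv j << c *g m >> = << c * lmexp j m *g lmdiv m (lmvar j) >>.
Proof. by rewrite (pderivw _ _ _ msuppU_le) big_seq_fset1 mcoeffUU. Qed.

Lemma pderiv0 j : pderiv j 0 = 0.
Proof. by apply: (addrI (pderiv j 0)); rewrite -pderivD !addr0. Qed.

Lemma lmexpM j m1 m2 : lmexp j (lmmul m1 m2) = lmexp j m1 + lmexp j m2.
Proof. by case: j => [|[|j]] //=; rewrite mulcmE. Qed.

Lemma lmdivMl j m1 m2 : lmexp j m1 != 0 ->
  lmdiv (lmmul m1 m2) (lmvar j) = lmmul (lmdiv m1 (lmvar j)) m2.
Proof.
case: j => [|[|j]] //= m1j; rewrite /lmdiv /lmmul /=.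
  congr (_, _); first by rewrite addrAC.
  by apply/eqP/cmP => i; rewrite !(divcmE, mulcmE, onecmE) !subn0.
congr (_, _); first by rewrite !subr0.
apply/eqP/cmP => i; rewrite !(divcmE, mulcmE, ucmE) addnBAC //.
by have [<-|//] := eqVneq j i; rewrite lt0n.
Qed.

Lemma laurentUU (a b : int) m1 m2 :
  (<< a *g m1 >> : laurent) * << b *g m2 >> = << a * b *g lmmul m1 m2 >>.
Proof. exact: lmulUU. Qed.

Lemma pderivM j (f g : laurent) :
  pderiv j (f * g) = pderiv j f * g + f * pderiv j g.
Proof.
elim/laurent_ind: f => [a m1||f1 f2 IH1 IH2].
- elim/laurent_ind: g => [b m2||g1 g2 IH1 IH2].
  + rewrite laurentUU !pderivU !laurentUU lmexpM mulrDr monalgUD.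
    have -> : << a * b * lmexp j m1 *g lmdiv (lmmul m1 m2) (lmvar j) >> =
              << a * lmexp j m1 * b *g lmmul (lmdiv m1 (lmvar j)) m2 >>.
      rewrite mulrAC; have [->|m1j] := eqVneq (lmexp j m1) 0.
        by rewrite mulr0 mul0r !monalgU0.
      by rewrite lmdivMl.
    have -> : << a * b * lmexp j m2 *g lmdiv (lmmul m1 m2) (lmvar j) >> =
              << a * (b * lmexp j m2) *g lmmul m1 (lmdiv m2 (lmvar j)) >>.
      rewrite mulrA; have [->|m2j] := eqVneq (lmexp j m2) 0.
        by rewrite !mulr0 !monalgU0.
      by rewrite (lmmulC m1 m2) (lmdivMl _ _ _ m2j) (lmmulC m1).
    by [].
  + by rewrite pderiv0 !mulr0 pderiv0 addr0.
  + by rewrite mulrDr !pderivD IH1 IH2 !mulrDr addrACA.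
- by rewrite pderiv0 !mul0r pderiv0 addr0.
- by rewrite mulrDl !pderivD IH1 IH2 !mulrDl addrACA.
Qed.

Lemma lmexp_div i j m : i != j -> lmexp i (lmdiv m (lmvar j)) = lmexp i m.
Proof.
case: i j => [|[|i]] [|[|j]] //= ij;
  rewrite ?divcmE ?onecmE ?subn0 ?subr0 // ucmE.
by rewrite eq_sym [i == j](_ : _ = false) ?subn0 //; apply: negbTE.
Qed.

Lemma lmdivAC m m1 m2 : lmdiv (lmdiv m m1) m2 = lmdiv (lmdiv m m2) m1.
Proof.
rewrite /lmdiv /=; congr (_, _); first by rewrite addrAC.
by apply/eqP/cmP => i; rewrite !divcmE subnAC.
Qed.

Lemma pderivC i j f : pderiv i (pderiv j f) = pderiv j (pderiv i f).
Proof.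
have [->//|ij] := eqVneq i j.
elim/laurent_ind: f => [c m||f1 f2 IH1 IH2]; last by rewrite !pderivD IH1 IH2.
  have ji : j != i by rewrite eq_sym.
  by rewrite !pderivU (lmexp_div _ _ _ ij) (lmexp_div _ _ _ ji) lmdivAC mulrAC.
by rewrite !pderiv0.
Qed.

Lemma pderivX j i : (0 < i)%N -> (0 < j)%N -> pderiv j (X i) = (i == j)%:R.
Proof.
case: i j => [|i] [|j] // _ _; rewrite /X pderivU mul1r.
have [->|ij] := eqVneq i.+1 j.+1.
  have -> : lmdiv (lmvar j.+1) (lmvar j.+1) = lmone.
    rewrite /lmdiv subrr; congr (_, _); apply/eqP/cmP => l.
    by rewrite divcmE subnn onecmE.
  by case: j => [|j] //=; rewrite ?ucmE ?eqxx.
have -> : lmexp j.+1 (lmvar i.+1) = 0.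
  case: i j ij => [|i] [|j] //= ij; rewrite ?onecmE // ucmE.
  by rewrite (negbTE ij : (i == j) = false).
by rewrite monalgU0.
Qed.

Lemma pderivX1z j a : (1 < j)%N -> pderiv j (X1z a) = 0.
Proof. by case: j => [|[|j]] // _; rewrite pderivU /= onecmE mulr0 monalgU0. Qed.

Lemma laurent_mulIn (n : nat) (f g : laurent) : f *+ n.+1 = g *+ n.+1 -> f = g.
Proof.
move=> fg; apply/malgP => m; apply/eqP; move/malgP/(_ m): fg.
rewrite !mcoeffMn => /eqP; rewrite -subr_eq0 -mulrnBl mulrn_eq0 /=.
by rewrite subr_eq0.
Qed.

Lemma pderiv_is_zmod_morphism j : zmod_morphism (pderiv j).
Proof.
move=> f g; apply: (addIr (pderiv j g)).
by rewrite -pderivD !subrK.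
Qed.

HB.instance Definition _ j :=
  GRing.isZmodMorphism.Build laurent laurent (pderiv j) (pderiv_is_zmod_morphism j).

Lemma pderiv1 j : pderiv j 1 = 0.
Proof.
by apply: (addrI (pderiv j 1)); rewrite addr0 -{3}[1]mulr1 pderivM mulr1 mul1r.
Qed.

Lemma pderiv_nat j n : pderiv j n%:R = 0.
Proof. by rewrite raddfMn /= pderiv1 mul0rn. Qed.

Lemma pderiv1X1z a : pderiv 1 (X1z a) = a%:~R * X1z (a - 1).
Proof.
rewrite /X1z pderivU mul1r /= /lmdiv /= [divcm _ _](_ : _ = onecm nat).
  by rewrite mulrzl -(raddfMz (mkmalgU _)) intz.
by apply/eqP/cmP => i; rewrite divcmE onecmE.
Qed.

(* The derivation X_j |-> X_(j+1), cut off at M to make the sum finite; M only has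
   to exceed the indices of the variables that occur in the argument. *)
Definition shiftD (M : nat) (f : laurent) : laurent :=
  \sum_(1 <= j < M) X j.+1 * pderiv j f.

Lemma shiftD_is_zmod_morphism M : zmod_morphism (shiftD M).
Proof.
move=> f g; rewrite /shiftD -sumrB; apply: eq_bigr => j _.
by rewrite raddfB mulrBr.
Qed.

HB.instance Definition _ M :=
  GRing.isZmodMorphism.Build laurent laurent (shiftD M) (shiftD_is_zmod_morphism M).

Lemma shiftDM M f g : shiftD M (f * g) = shiftD M f * g + f * shiftD M g.
Proof.
rewrite /shiftD mulr_suml mulr_sumr -big_split /=.
by apply: eq_bigr => j _; rewrite pderivM mulrDr mulrA (mulrCA f).
Qed.

Lemma shiftDX M i : (0 < i < M)%N -> shiftD M (X i) = X i.+1.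
Proof.
move=> /andP[i_gt0 iM]; rewrite /shiftD (big_rem i) ?mem_index_iota ?i_gt0 //=.
rewrite pderivX // eqxx mulr1 big_seq big1 ?addr0 // => j.
rewrite mem_rem_uniq ?iota_uniq // inE mem_index_iota => /and3P[ji j_gt0 _].
by rewrite pderivX // eq_sym (negbTE ji) mulr0.
Qed.

Lemma shiftDX1z M a : (1 < M)%N -> shiftD M (X1z a) = a%:~R * X1z (a - 1) * X 2.
Proof.
move=> M_gt1; rewrite /shiftD big_ltn // pderiv1X1z big_seq big1 ?addr0 => [|j].
  by rewrite mulrC.
by rewrite mem_index_iota => /andP[j_gt1 _]; rewrite pderivX1z // mulr0.
Qed.

Lemma SpolyS n k : (k <= n)%N ->
  Spoly n.+1 k.+1 =
    - (2%:R * n%:R - 1) * X 2 * Spoly n k.+1 +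
    X 1 * (Spoly n k +
           \sum_(1 <= j < (n.+1 - k.+1).+1) X j.+1 * pderiv j (Spoly n k.+1)).
Proof. by move=> kn; rewrite {1}/Spoly ltnS kn. Qed.

Lemma Spoly_small n k : (n < k)%N -> Spoly n k = 0.
Proof. by case: n k => [|n] [|k] //= nk; rewrite leqNgt nk. Qed.

Lemma pderiv_Spoly n k j : (0 < j)%N -> (n.+1 < j + k)%N ->
  pderiv j (Spoly n k) = 0.
Proof.
elim: n k => [|n IHn] k j_gt0 jk.
  case: k jk => [|k] jk /=; last by rewrite raddf0.
  by rewrite pderivX1z //; lia.
case: k jk => [|k] jk; first by rewrite raddf0.
have [kn|nk] := leqP k n; last by rewrite Spoly_small // raddf0.
rewrite SpolyS //.
have jX2 : pderiv j (X 2) * Spoly n k.+1 = 0.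
  have [j2|j2] := eqVneq j 2%N; first by rewrite Spoly_small ?mulr0 //; lia.
  by rewrite pderivX // eq_sym (negbTE j2) mul0r.
have jX1 : pderiv j (X 1) = 0 by rewrite pderivX //; case: eqP => //; lia.
have jc : pderiv j (- (2%:R * n%:R - 1)) = 0.
  by rewrite raddfN raddfB /= -natrM pderiv_nat pderiv1 subr0 oppr0.
rewrite pderivD !(pderivM _ _ (Spoly _ _)) (IHn k.+1) //; last by lia.
rewrite mulr0 addr0 (pderivM _ _ (X 2)) jc mul0r add0r -mulrA jX2 mulr0 add0r.
rewrite (pderivM _ (X 1)) jX1 mul0r add0r pderivD IHn //; last by lia.
rewrite add0r raddf_sum /= big_nat_cond big1 ?mulr0 // => i /andP[/andP[i_gt0 ik] _].
rewrite pderivM pderivX // pderivC (IHn k.+1) //; last by lia.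
by rewrite raddf0 mulr0 addr0; case: eqP => [|_]; [lia | rewrite mul0r].
Qed.

Lemma shiftD_Spoly M n k : (n.+1 < M + k)%N ->
  shiftD M (Spoly n k) = \sum_(1 <= j < (n.+1 - k).+1) X j.+1 * pderiv j (Spoly n k).
Proof.
move=> nM; rewrite /shiftD.
have [kn|nk] := leqP k n; last first.
  by rewrite Spoly_small // !big1 // => j _; rewrite raddf0 mulr0.
rewrite (@big_cat_nat _ _ _ (n.+1 - k).+1) //=; last by lia.
rewrite [X in _ + X]big_nat_cond [X in _ + X]big1 ?addr0 // => j /andP[/andP[jk _] _].
by rewrite pderiv_Spoly ?mulr0 //; lia.
Qed.

Lemma ApolyS n k M : (n.+1 < M)%N ->
  X 1 * Apoly n.+1 k.+1 = Apoly n k + shiftD M (Apoly n k.+1).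
Proof.
move=> nM; rewrite /Apoly shiftDM shiftDX1z; last by lia.
have [kn|nk] := leqP k n; last first.
  by rewrite !Spoly_small ?raddf0 ?mulr0 ?addr0 //; lia.
rewrite SpolyS // -(shiftD_Spoly M); last by lia.
set e := - (2 * n%:Z - 1).
rewrite mulrA; have -> : X 1 * X1z (- (2 * n.+1%:Z - 1)) = X1z (e - 1).
  by rewrite -X1z1 -X1zD; congr X1z; rewrite /e; lia.
have -> : X1z e = X1z (e - 1) * X 1 by rewrite -X1z1 -X1zD subrK.
have -> : e%:~R = - (2%:R * n%:R - 1) :> laurent.
  by rewrite /e rmorphN rmorphB rmorphM.
move: (- (2%:R * n%:R - 1)) => c.
by rewrite !mulrDr !mulrA (mulrC c) addrCA.
Qed.

(* The index type does not depend on n and k, so that r |-> r + e_i maps it to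
   itself; BellE says when the box is large enough. *)
Definition box_Bell (N M n k : nat) : laurent :=
  \sum_(r : {ffun 'I_N -> 'I_M.+1} |
        (\sum_(i < N) r i == k)%N && (\sum_(i < N) i.+1 * r i == n)%N)
    (bell_coef n (fun i => r i : nat))%:R * \prod_(i < N) X i.+1 ^+ r i.

Lemma eq_bell_coef n l (r s : 'I_l -> nat) : r =1 s -> bell_coef n r = bell_coef n s.
Proof.
move=> rs; rewrite /bell_coef.
by congr (_ %/ (_ * _))%N; apply: eq_bigr => i _; rewrite rs.
Qed.

Lemma bell_coef_incr l (r : 'I_l -> nat) (i : 'I_l) m :
  (\sum_(j < l) j.+1 * r j = m)%N ->
  ((r i).+1 * bell_coef (m + i.+1) (fun j => r j + (j == i)) =
   'C(m + i.+1, i.+1) * bell_coef m r)%N.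
Proof.
move=> rm; set s := fun j => _.
have sm : (\sum_(j < l) j.+1 * s j = m + i.+1)%N.
  rewrite -rm /s; under eq_bigr => j _ do rewrite mulnDr.
  rewrite big_split /=; congr (_ + _)%N.
  by rewrite (bigD1 i) //= eqxx muln1 big1 ?addn0 // => j /negbTE ->; rewrite muln0.
have := bell_coefE sm; have := bell_coefE rm.
rewrite (bigD1 i) //= (bigD1 i (F := fun j => _ ^ _)%N) //=.
rewrite (bigD1 i (F := fun j => (s j)`!)%N) //= (bigD1 i (F := fun j => _ ^ s j)%N) //=.
have -> : (\prod_(j < l | j != i) (s j)`! = \prod_(j < l | j != i) (r j)`!)%N.
  by apply: eq_bigr => j /negbTE ji; rewrite /s ji addn0.
have -> : (\prod_(j < l | j != i) j.+1`! ^ s j = \prod_(j < l | j != i) j.+1`! ^ r j)%N.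
  by apply: eq_bigr => j /negbTE ji; rewrite /s ji addn0.
have -> : s i = (r i).+1 by rewrite /s eqxx addn1.
have a_gt0 : (0 < \prod_(j < l | j != i) (r j)`!)%N.
  by apply: prodn_cond_gt0 => j _; apply: fact_gt0.
have b_gt0 : (0 < \prod_(j < l | j != i) j.+1`! ^ r j)%N.
  by apply: prodn_cond_gt0 => j _; rewrite expn_gt0 fact_gt0.
move: (\prod_(j < l | j != i) (r j)`!)%N a_gt0 => a a_gt0.
move: (\prod_(j < l | j != i) _)%N b_gt0 => b b_gt0.
rewrite (factS (r i)) expnS => rE sE.
have := bin_fact (leq_addl m i.+1); rewrite addnK -sE -rE.
set c := bell_coef m r; set d := bell_coef _ s; set w := 'C(_, _).
have := fact_gt0 (r i); have := fact_gt0 i.+1.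
move: (r i)`! => g; move: (r i) i.+1`! => t f f_gt0 g_gt0 E.
have fg_gt0 : (0 < f * (g * a * (f ^ t * b)))%N.
  by rewrite !muln_gt0 expn_gt0 f_gt0 g_gt0 a_gt0 b_gt0.
apply/eqP; rewrite -(eqn_pmul2r fg_gt0); apply/eqP.
have -> : (w * c * (f * (g * a * (f ^ t * b))) =
           w * (f * (c * (g * a * (f ^ t * b)))))%N by lia.
rewrite E; lia.
Qed.

Lemma exponent_sums l (r : 'I_l -> nat) n k (i : 'I_l) :
    (\sum_(j < l) r j = k)%N -> (\sum_(j < l) j.+1 * r j = n)%N ->
  [/\ (r i <= k)%N, (i.+1 * r i <= n)%N & (k + i * r i <= n)%N].
Proof.
move=> rk rn; split; first by rewrite -rk (bigD1 i) //= leq_addr.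
  by rewrite -rn (bigD1 i) //= leq_addr.
rewrite -rk -rn.
have -> : (\sum_(j < l) j.+1 * r j = \sum_(j < l) r j + \sum_(j < l) j * r j)%N.
  by rewrite -big_split /=; apply: eq_bigr => j _; rewrite mulSn.
by rewrite leq_add2l [leqRHS](bigD1 i) //= leq_addr.
Qed.

Lemma big_ord_outside (R : Type) (idx : R) (op : Monoid.law idx) l N (le_lN : (l <= N)%N)
    (F : 'I_N -> R) : (forall j : 'I_N, (l <= j)%N -> F j = idx) ->
  \big[op/idx]_(j < N) F j = \big[op/idx]_(i < l) F (widen_ord le_lN i).
Proof.
move=> F0; rewrite -(big_ord_narrow le_lN) [RHS]big_mkcond.
by apply: eq_bigr => j _; case: ltnP => // /F0.
Qed.

Lemma box_Bell_widen l N K M n k :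
    (l < N)%N -> (K <= M)%N -> (n - k <= l)%N -> (k <= K)%N ->
  box_Bell N M n k = box_Bell l.+1 K n k.
Proof.
move=> lN KM nkl kK.
pose h (r : {ffun 'I_l.+1 -> 'I_K.+1}) : {ffun 'I_N -> 'I_M.+1} :=
  [ffun j : 'I_N => inord (if (j < l.+1)%N then r (inord j) : nat else 0%N)].
pose h' (s : {ffun 'I_N -> 'I_M.+1}) : {ffun 'I_l.+1 -> 'I_K.+1} :=
  [ffun i => inord (s (widen_ord lN i))].
have hE r j : h r j = (if (j < l.+1)%N then r (inord j) : nat else 0%N) :> nat.
  rewrite ffunE inordK //; case: ifP => // _.
  by rewrite ltnS; apply: leq_trans KM; rewrite -ltnS.
have hw r i : h r (widen_ord lN i) = r i :> nat by rewrite hE /= ltn_ord inord_val.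
have h0 r (j : 'I_N) : (l < j)%N -> h r j = 0%N :> nat by move=> lj; rewrite hE ltnNge lj.
rewrite /box_Bell (reindex_onto h h').
  have h'K r : h' (h r) == r.
    apply/eqP/ffunP => i; apply: val_inj; rewrite ffunE /= hw inordK //.
  apply: eq_big => r; last move=> _.
    rewrite h'K andbT !(big_ord_outside _ _ _ _ _ lN).
    - by congr (_ && _); congr (_ == _); apply: eq_bigr => i _; rewrite hw.
    - by move=> j /h0 ->; rewrite muln0.
    - by move=> j /h0 ->.
  rewrite /bell_coef !(big_ord_outside _ _ _ _ _ lN).
  - congr (_%:R * _); last by apply: eq_bigr => i _; rewrite hw.
    by congr (_ %/ (_ * _))%N; apply: eq_bigr => i _; rewrite hw.
  - by move=> j /h0 ->; rewrite expr0.
  - by move=> j /h0 ->.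
  - by move=> j /h0 ->.
move=> s /andP[/eqP sk /eqP sn]; apply/ffunP => j; apply: val_inj => /=.
have [sj _ kj] := exponent_sums _ (fun j => s j) _ _ j sk sn.
rewrite hE; case: ltnP => [jl|lj].
  rewrite ffunE inordK; last first.
    rewrite ltnS; apply: leq_trans kK.
    by rewrite (_ : widen_ord _ _ = j) //; apply: val_inj; rewrite /= inordK.
  by congr (val (s _)); apply: val_inj; rewrite /= inordK.
case: (s j : nat) kj => // t kj; exfalso; move: nkl lj kj; rewrite mulnS; lia.
Qed.

Lemma Bell_small n k : (n < k)%N -> Bell n k = 0.
Proof. by case: k => // k nk; rewrite /Bell nk. Qed.

Lemma Bell0 n : Bell n 0 = (n == 0%N)%:R.
Proof. by []. Qed.

Lemma BellE N M n k : (n - k < N)%N -> (k <= M)%N -> Bell n k = box_Bell N M n k.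
Proof.
move=> nkN kM; have [->|k_gt0] := posnP k.
  rewrite Bell0 /box_Bell; have [->|n_neq0] := eqVneq n 0%N.
    rewrite (big_pred1 [ffun => ord0]) => [|r].
      rewrite big1 ?mulr1 => [|i _]; last by rewrite ffunE expr0.
      rewrite /bell_coef !big1 ?divn1 // => i _; by rewrite ffunE.
    apply/andP/eqP => [[/eqP r0 _]|->].
      apply/ffunP => i; apply: val_inj; apply/eqP; rewrite ffunE /= -leqn0 -r0.
      by rewrite (bigD1 i) //= leq_addr.
    by rewrite !big1 // => i _; rewrite ffunE ?muln0.
  rewrite big_pred0 // => r; apply/negP => /andP[/eqP r0 /eqP rn].
  case/eqP: n_neq0; rewrite -rn big1 // => i _; apply/eqP.
  by rewrite muln_eq0 /= -leqn0 -[X in (_ <= X)%N]r0 (bigD1 i) //= leq_addr.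
have [nk|kn] := ltnP n k.
  rewrite Bell_small // /box_Bell big_pred0 // => r; apply/negP => /andP[/eqP rk /eqP rn].
  move: nk; rewrite -rk -rn ltnNge; case/negP.
  by apply: leq_sum => i _; rewrite leq_pmull.
rewrite (box_Bell_widen (n - k)%N _ k) //.
by rewrite /Bell eqn0Ngt k_gt0 ltnNge kn.
Qed.

Lemma box_Bell_rec N M n k : (k < M)%N ->
  k.+1%:R * box_Bell N M n k.+1 =
  \sum_(i < N) 'C(n, i.+1)%:R * (X i.+1 * box_Bell N M (n - i.+1) k).
Proof.
move=> kM; rewrite mulr_sumr.
transitivity (\sum_(r : {ffun 'I_N -> 'I_M.+1} |
    (\sum_(i < N) r i == k.+1)%N && (\sum_(i < N) i.+1 * r i == n)%N)
    \sum_(i < N) (r i)%:R * ((bell_coef n (fun i => r i : nat))%:R *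
      \prod_(i < N) X i.+1 ^+ r i)).
  by apply: eq_bigr => r /andP[/eqP rk _]; rewrite -mulr_suml -natr_sum rk.
rewrite exchange_big; apply: eq_bigr => i _ /=.
rewrite (bigID (fun r : {ffun 'I_N -> 'I_M.+1} => 0 < r i)%N) /=.
rewrite addrC big1 ?add0r; last first.
  by move=> r /andP[_]; rewrite -eqn0Ngt => /eqP ->; rewrite mul0r.
have [ni|i_n] := ltnP n i.+1.
  rewrite bin_small // mul0r big_pred0 // => r; apply/negP.
  move=> /andP[/andP[/eqP rk /eqP rn] ri].
  have [_ + _] := exponent_sums _ (fun j => r j) _ _ i rk rn.
  by case: (r i : nat) ri => // t _; rewrite mulnS; lia.
pose h (r : {ffun 'I_N -> 'I_M.+1}) : {ffun 'I_N -> 'I_M.+1} :=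
  [ffun j => inord (r j + (j == i))].
pose h' (r : {ffun 'I_N -> 'I_M.+1}) : {ffun 'I_N -> 'I_M.+1} :=
  [ffun j => inord (r j - (j == i))].
have h'E r j : h' r j = (r j - (j == i))%N :> nat.
  by rewrite ffunE inordK //; apply: leq_ltn_trans (leq_subr _ _) (ltn_ord _).
rewrite (reindex_onto h h') => [|r /andP[_ ri]]; last first.
  apply/ffunP => j; apply: val_inj; rewrite ffunE /= h'E subnK ?inordK //.
  by case: eqP => // ->.
have hE (r : {ffun 'I_N -> 'I_M.+1}) j : (r i < M)%N -> h r j = (r j + (j == i))%N :> nat.
  move=> ri; rewrite ffunE inordK //; have [->|_] := eqVneq j i.
    by rewrite addn1.
  by rewrite addn0.
(* inord sends the out-of-range value M.+1 to 0. *)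
have h_over (r : {ffun 'I_N -> 'I_M.+1}) : (M <= r i)%N -> h r i = 0%N :> nat.
  by move=> riM; rewrite ffunE eqxx /inord /insubd insubN //= addn1 ltnS -leqNgt.
have hwt (r : {ffun 'I_N -> 'I_M.+1}) : (r i < M)%N ->
    (\sum_(j < N) j.+1 * h r j = \sum_(j < N) j.+1 * r j + i.+1)%N.
  move=> ri; under eq_bigr => j _ do rewrite hE // mulnDr.
  rewrite big_split /=; congr (_ + _)%N.
  by rewrite (bigD1 i) //= eqxx muln1 big1 ?addn0 // => j /negbTE ->; rewrite muln0.
rewrite /box_Bell [X _ * _]mulr_sumr [RHS]mulr_sumr; apply: eq_big => r.
  have [riM|riM] := ltnP (r i) M; last first.
    rewrite h_over // andbF /=; apply/esym/negP => /andP[/eqP rk _].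
    by move: kM; rewrite -rk ltnNge (bigD1 i) //= (leq_trans riM) ?leq_addr.
  have h'K : h' (h r) == r.
    by apply/eqP/ffunP => j; apply: val_inj; rewrite /= h'E hE // addnK.
  rewrite h'K andbT hE // eqxx addn1 andbT.
  have -> : (\sum_(j < N) h r j = (\sum_(j < N) r j).+1)%N.
    under eq_bigr => j _ do rewrite hE //.
    rewrite big_split /= -[RHS]addn1; congr (_ + _)%N.
    by rewrite (bigD1 i) //= eqxx big1 // => j /negbTE ->.
  rewrite hwt //.
  by rewrite eqSS; congr (_ && _); apply/eqP/eqP; lia.
move=> /andP[/andP[/andP[_ /eqP rn] hri] _].
have riM : (r i < M)%N by rewrite ltnNge; apply/negP => /h_over hri0; rewrite hri0 in hri.
rewrite (hwt _ riM) in rn.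
rewrite (eq_bell_coef _ _ _ (fun j => r j + (j == i))%N) => [|j]; last exact: hE.
have -> : \prod_(j < N) X j.+1 ^+ h r j = X i.+1 * \prod_(j < N) X j.+1 ^+ r j.
  rewrite (bigD1 i) //= [X in _ = _ * X](bigD1 i) //= hE // eqxx addn1 exprS -mulrA.
  congr (_ * (_ * _)); apply: eq_bigr => j /negbTE ji.
  by rewrite hE // ji addn0.
move: (\prod_(j < N) _) (X i.+1) => P x.
rewrite (hE _ _ riM) eqxx addn1 -rn addnK mulrA -natrM.
rewrite (bell_coef_incr _ (fun j => r j : nat) _ _ erefl) natrM.
by rewrite -mulrA (mulrCA x).
Qed.

Lemma Bell_rec n k :
  k.+1%:R * Bell n k.+1 =
  \sum_(i < n.+1) 'C(n, i.+1)%:R * (X i.+1 * Bell (n - i.+1) k).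
Proof.
rewrite (BellE n.+1 k.+1) //; last by rewrite ltnS leq_subr.
rewrite box_Bell_rec //; apply: eq_bigr => i _.
by rewrite -(BellE n.+1 k.+1) //; lia.
Qed.

Lemma BellS n k M : (n < M)%N ->
  Bell n.+1 k.+1 = X 1 * Bell n k + shiftD M (Bell n k.+1).
Proof.
move=> nM; apply: (derivation_partial_Bell _ (shiftD M) X _ M) => //.
- exact: shiftDM.
- exact: shiftDX.
- exact: laurent_mulIn.
- exact: Bell_rec.
Qed.

Lemma Apoly_small n k : (n < k)%N -> Apoly n k = 0.
Proof. by move=> nk; rewrite /Apoly Spoly_small // mulr0. Qed.

Lemma Apoly0 k : Apoly 0 k = (k == 0%N)%:R.
Proof. by case: k => [|k]; rewrite /Apoly ?mulr0 // -X1zD. Qed.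

Lemma ApolyS0 n : Apoly n.+1 0 = 0.
Proof. by rewrite /Apoly mulr0. Qed.

Lemma Bell_0n k : Bell 0 k = (k == 0%N)%:R.
Proof. by case: k => [|k] //; rewrite Bell_small. Qed.

Lemma lreg_X1 : GRing.lreg (X 1).
Proof.
move=> f g /(congr1 ( *%R (X1z (- 1)))).
by rewrite !mulrA -X1z1 -X1zD addNr X1z0 !mul1r.
Qed.

Theorem theorem5p1 (n k : nat) (k_ge1 : (1 <= k)%N) (k_le_n : (k <= n)%N) :
  \sum_(k <= j < n.+1) Apoly n j * Bell j k = (n == k)%:R /\
  \sum_(k <= j < n.+1) Bell n j * Apoly j k = (n == k)%:R.
Proof.
have AS m l : (m < n)%N ->
    X 1 * Apoly m.+1 l.+1 = 1 * Apoly m l + shiftD n.+1 (Apoly m l.+1).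
  by move=> mn; rewrite mul1r; apply: ApolyS.
have BS m l : (m < n)%N ->
    1 * Bell m.+1 l.+1 = X 1 * Bell m l + shiftD n.+1 (Bell m l.+1).
  by move=> mn; rewrite mul1r; apply: BellS; apply: ltnW.
have from0 (F : nat -> laurent) : (forall j, (j < k)%N -> F j = 0) ->
    \sum_(k <= j < n.+1) F j = \sum_(j < n.+1) F j.
  move=> F0; rewrite -(big_mkord xpredT F) (@big_cat_nat _ _ _ k 0 n.+1) //=.
    rewrite [X in _ = X + _]big_nat_cond [X in _ = X + _]big1 ?add0r //.
    by move=> j /andP[/andP[_ jk] _]; apply: F0.
  exact: leqW.
split.
  rewrite from0 => [|j jk]; last by rewrite Bell_small // mulr0.
  apply: (mutually_inverse_triangles _ (shiftD n.+1) (X 1) 1 Apoly Bell n) => //.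
  - exact: shiftDM.
  - exact: lreg_X1.
  - exact: Apoly0.
  - exact: ApolyS0.
  - exact: Apoly_small.
  - exact: Bell_0n.
rewrite from0 => [|j jk]; last by rewrite Apoly_small // mulr0.
apply: (mutually_inverse_triangles _ (shiftD n.+1) 1 (X 1) Bell Apoly n) => //.
- exact: shiftDM.
- exact: lreg1.
- exact: Bell_0n.
- exact: Bell_small.
- exact: Apoly0.
- exact: ApolyS0.
Qed.
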